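(* Let $A\in\mathcal{PM}(n)$, $B\in\mathcal{PM}(m)$ and $i\in[n]$. Then $A\circ^{\max}_{n-i+1}B=\left(A^*\circ^{\min}_i B^*\right)^*$.
   Context: A poset matrix of order $n$ is an $n\times n$ $(0,1)$-matrix $A=[a_{st}]$ that is lower triangular with all diagonal entries $1$ and transitive ($a_{st}=a_{tu}=1\Rightarrow a_{su}=1$); $\mathcal{PM}(n)$ is the set of these. For $A$ of order $N$, its dual is $A^*=EA^TE$, where $E$ is the $N\times N$ backward identity matrix. The poset associated to $B=[b_{st}]\in\mathcal{PM}(m)$ is $[m]$ with $t\le s$ iff $b_{st}=1$. $A[\alpha\mid\beta]$ is the submatrix with rows $\alpha$ and columns $\beta$, $A[\alpha]=A[\alpha\mid\alpha]$. For $A\in\mathcal{PM}(n)$ and $i\in[n]$: $A_{11}=A[\{1..i-1\}]$, $A_{22}=A[\{i+1..n\}]$, $A_{21}=A[\{i+1..n\}\mid\{1..i-1\}]$, $A_{(i)}=A[\{i\}\mid\{1..i-1\}]$, $A^{(i)}=A[\{i+1..n\}\mid\{i\}]$; empty blocks are vacuous. For $B\in\mathcal{PM}(m)$: $A\circ^{\min}_i B=\begin{pmatrix}A_{11}&\mathbb{O}&\mathbb{O}\\ \mathbb{1}_m^T\otimes A_{(i)}&B&\mathbb{O}\\ A_{21}&\mathrm{Min}_i(A,B)&A_{22}\end{pmatrix}$, $A\circ^{\max}_i B=\begin{pmatrix}A_{11}&\mathbb{O}&\mathbb{O}\\ \mathrm{Max}_i(A,B)&B&\mathbb{O}\\ A_{21}&\mathbb{1}_m\otimes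 A^{(i)}&A_{22}\end{pmatrix}$, where $\mathbb{1}_m^T\otimes A_{(i)}$ is the $m\times(i-1)$ matrix with all rows $A_{(i)}$, $\mathbb{1}_m\otimes A^{(i)}$ the $(n-i)\times m$ matrix with all columns $A^{(i)}$, $\mathrm{Min}_i(A,B)$ the $(n-i)\times m$ matrix whose $j$-th column is $A^{(i)}$ if $j$ is minimal in the poset of $B$ and zero otherwise, and $\mathrm{Max}_i(A,B)$ the $m\times(i-1)$ matrix whose $j$-th row is $A_{(i)}$ if $j$ is maximal in the poset of $B$ and zero otherwise. *)

(* Defs.v *)
From mathcomp Require Import all_boot all_order all_algebra.
Set Implicit Arguments.
Unset Strict Implicit.
Unset Printing Implicit Defensive.
Import GRing.Theory.
Local Open Scope ring_scope.

(* Rows and columns are indexed by 'I_n = {0, ..., n - 1}: the 1-based position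
   i is the ordinal of value i - 1, and n - i + 1 is its image by rev_ord. *)

Definition PM n : {pred 'M[int]_n} :=
  [pred A : 'M[int]_n |
    [&& [forall s, forall t, (A s t == 0) || (A s t == 1)],
        is_trig_mx A,
        [forall s, A s s == 1]
      & [forall s, forall t, forall u,
           (A s t == 1) && (A t u == 1) ==> (A s u == 1)]]].
Arguments PM n _ : clear implicits.

Definition backward_mx N : 'M[int]_N := \matrix_(s, t) (t == rev_ord s)%:R.

Definition dual_mx N (A : 'M[int]_N) : 'M[int]_N :=
  backward_mx N *m A^T *m backward_mx N.

(* The row index is the larger element. *)
Definition poset_le m (B : 'M[int]_m) : rel 'I_m := fun t s => B s t == 1.

Definition minimal m (B : 'M[int]_m) (j : 'I_m) : bool :=
  [forall t, poset_le B t j ==> (t == j)].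

Definition maximal m (B : 'M[int]_m) (j : 'I_m) : bool :=
  [forall t, poset_le B j t ==> (t == j)].

Definition before n (i : 'I_n) : 'I_i -> 'I_n :=
  widen_ord (ltnW (ltn_ord i)).
Arguments before {n} i _.

Lemma after_subproof n (i : 'I_n) (k : 'I_(n - i.+1)) : (i.+1 + k < n)%N.
Proof. by rewrite -ltn_subRL ltn_ord. Qed.

Definition after n (i : 'I_n) (k : 'I_(n - i.+1)) : 'I_n :=
  Ordinal (after_subproof k).
Arguments after {n} i k.

Definition row_before n (i : 'I_n) (A : 'M[int]_n) : 'rV[int]_i :=
  mxsub (fun=> i) (before i) A.

Definition col_after n (i : 'I_n) (A : 'M[int]_n) : 'cV[int]_(n - i.+1) :=
  mxsub (after i) (fun=> i) A.

Lemma compo_order n m (i : 'I_n) : (i + (m + (n - i.+1)) = (n + m).-1)%N.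
Proof.
have e := subnKC (ltn_ord i).
by rewrite addnCA addnC -[in RHS]e !addSn.
Qed.

(* The common shape of the two compositions, with the blocks in positions
   (2,1) and (3,2) left as parameters. *)
Definition compo n m (A : 'M[int]_n) (i : 'I_n) (B : 'M[int]_m)
    (P : 'M[int]_(m, i)) (Q : 'M[int]_(n - i.+1, m)) : 'M[int]_((n + m).-1) :=
  let A11 := mxsub (before i) (before i) A in
  let A21 := mxsub (after i) (before i) A in
  let A22 := mxsub (after i) (after i) A in
  castmx (compo_order m i, compo_order m i)
    (col_mx (row_mx A11 (row_mx 0 0))
    (col_mx (row_mx P   (row_mx B 0))
            (row_mx A21 (row_mx Q A22)))).
Arguments compo {n m} A i B P Q.

Definition Min_mx n m (i : 'I_n) (A : 'M[int]_n) (B : 'M[int]_m) :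
    'M[int]_(n - i.+1, m) :=
  \matrix_(s, j) if minimal B j then col_after i A s 0 else 0.

Definition Max_mx n m (i : 'I_n) (A : 'M[int]_n) (B : 'M[int]_m) :
    'M[int]_(m, i) :=
  \matrix_(j, t) if maximal B j then row_before i A 0 t else 0.

Definition compo_min n m (A : 'M[int]_n) (i : 'I_n) (B : 'M[int]_m) :
    'M[int]_((n + m).-1) :=
  compo A i B (\matrix_(j, t) row_before i A 0 t) (Min_mx i A B).

Definition compo_max n m (A : 'M[int]_n) (i : 'I_n) (B : 'M[int]_m) :
    'M[int]_((n + m).-1) :=
  compo A i B (Max_mx i A B) (\matrix_(s, j) col_after i A s 0).

(* Main.v *)
(** Conjugating a transpose by the backward identity reverses and swaps both
    indices: [A^*_{s,t} = A_{N+1-t,N+1-s}].  Index reversal exchanges the index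
    blocks before and after the insertion point, keeps the block of [B], and
    sends minimal elements of [B^*] to maximal elements of [B]; hence both sides
    agree on each of the nine blocks. *)
Require Import Defs.
From mathcomp Require Import all_boot all_order all_algebra.
From mathcomp Require Import zify.
Set Implicit Arguments.
Unset Strict Implicit.
Unset Printing Implicit Defensive.
Import GRing.Theory.
Local Open Scope ring_scope.

Lemma dual_mxE N (A : 'M[int]_N) s t : dual_mx A s t = A (rev_ord t) (rev_ord s).
Proof.
(* Column [t] of [backward_mx N] has its only nonzero entry in row [rev_ord t]; the inner product
   collapses likewise to [rev_ord s]. *)
rewrite /dual_mx mxE (bigD1 (rev_ord t)) //= big1 => [|k kt].
  rewrite !mxE rev_ordK eqxx mulr1 addr0 (bigD1 (rev_ord s)) //= big1 => [|k ks].
    by rewrite !mxE eqxx mul1r addr0.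
  by rewrite !mxE (negPf ks) mul0r.
by rewrite !mxE -(inj_eq rev_ord_inj) rev_ordK eq_sym (negPf kt) mulr0.
Qed.

(** [rev_ord] carries [poset_le (dual_mx B)] to the converse of [poset_le B]. *)
Lemma minimal_dual m (B : 'M[int]_m) j :
  minimal (dual_mx B) j = maximal B (rev_ord j).
Proof.
apply/forallP/forallP => h t; have := h (rev_ord t);
  by rewrite /poset_le !dual_mxE ?rev_ordK -(inj_eq rev_ord_inj) ?rev_ordK.
Qed.

(** Block coordinates, nested as in [compo], so that an entry is found by case analysis on its two
    indices. *)
Definition compo_block n m (i : 'I_n) : Type := ('I_i + ('I_m + 'I_(n - i.+1)))%type.

Definition compo_index n m (i : 'I_n) (x : compo_block m i) : 'I_((n + m).-1) :=
  cast_ord (compo_order m i)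
    (unsplit (match x with inl k => inl k | inr y => inr (unsplit y) end)).

Lemma compo_index_surj n m (i : 'I_n) (s : 'I_((n + m).-1)) :
  exists x : compo_block m i, s = compo_index x.
Proof.
have e := compo_order m i.
case: (split_ordP (cast_ord (esym e) s)) => [k ek|y ey].
  (* The value of [s] is refolded as that of its cast, to which [ek] applies. *)
  by exists (inl k); apply/val_inj; rewrite /= -[LHS]/(val (cast_ord (esym e) s)) ek.
case: (split_ordP y) => [j ej|k ek].
  exists (inr (inl j)); apply/val_inj.
  by rewrite /= -[LHS]/(val (cast_ord (esym e) s)) ey ej.
exists (inr (inr k)); apply/val_inj.
by rewrite /= -[LHS]/(val (cast_ord (esym e) s)) ey ek.
Qed.

Lemma compoE n m (A : 'M[int]_n) (i : 'I_n) (B : 'M[int]_m) P Q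
    (x y : compo_block m i) :
  compo A i B P Q (compo_index x) (compo_index y) =
  match x, y with
  | inl s, inl t => A (before i s) (before i t)
  | inl _, inr _ => 0
  | inr (inl j), inl t => P j t
  | inr (inl j), inr (inl k) => B j k
  | inr (inl _), inr (inr _) => 0
  | inr (inr s), inl t => A (after i s) (before i t)
  | inr (inr s), inr (inl k) => Q s k
  | inr (inr s), inr (inr t) => A (after i s) (after i t)
  end.
Proof.
rewrite /compo castmxE !cast_ordK.
by case: x => [s|[j|s]]; case: y => [t|[k|t]];
  rewrite /= ?(col_mxEu, col_mxEd, row_mxEl, row_mxEr) ?mxE.
Qed.

(** Not a conversion, hence the [cast_ord] in [rev_block]. *)
Lemma sub_rev_ord n (i : 'I_n) : (n - (rev_ord i).+1 = i)%N.
Proof. by have := ltn_ord i; rewrite /=; lia. Qed.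

(* [rev_ord k : 'I_(n - i.+1)] typechecks below because [rev_ord i] has value
   [n - i.+1] by conversion. *)
Definition rev_block n m (i : 'I_n) (x : compo_block m (rev_ord i)) :
    compo_block m i :=
  match x with
  | inl k => inr (inr (rev_ord k))
  | inr (inl j) => inr (inl (rev_ord j))
  | inr (inr k) => inl (cast_ord (sub_rev_ord i) (rev_ord k))
  end.

Lemma rev_compo_index n m (i : 'I_n) (x : compo_block m (rev_ord i)) :
  rev_ord (compo_index x) = compo_index (rev_block x).
Proof.
apply/val_inj; have := ltn_ord i.
by case: x => [k|[k|k]]; have := ltn_ord k; rewrite /=; lia.
Qed.

Lemma rev_after n (i : 'I_n) (k : 'I_(rev_ord i)) :
  rev_ord (after i (rev_ord k)) = before (rev_ord i) k.
Proof.
by apply/val_inj; have := ltn_ord i; have := ltn_ord k; rewrite /=; lia.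
Qed.

Lemma rev_before n (i : 'I_n) (k : 'I_(n - (rev_ord i).+1)) :
  rev_ord (before i (cast_ord (sub_rev_ord i) (rev_ord k))) =
  after (rev_ord i) k.
Proof.
by apply/val_inj; have := ltn_ord i; have := ltn_ord k; rewrite /=; lia.
Qed.

Theorem theorem11 (n m : nat) (A : 'M[int]_n) (B : 'M[int]_m) (i : 'I_n)
    (hA : A \in PM n) (hB : B \in PM m) :
  compo_max A (rev_ord i) B = dual_mx (compo_min (dual_mx A) i (dual_mx B)).
Proof.
apply/matrixP => s t; rewrite dual_mxE.
have [x ->] := compo_index_surj (rev_ord i) s.
have [y ->] := compo_index_surj (rev_ord i) t.
rewrite !rev_compo_index /compo_max /compo_min !compoE.
(* Reversal with transposition exchanges positions (2,1) and (3,2), so [minimal_dual] matches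
   [Max_mx] with [Min_mx]. *)
by case: x => [k|[k|k]]; case: y => [l|[l|l]] //=;
  rewrite ?(minimal_dual, dual_mxE, mxE) ?rev_ordK ?rev_after ?rev_before.
Qed.
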